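(* Let $\alpha,\beta>0$ and let $$\mathcal U=\bigl\{\mathbf u=(f,b,g,q)^\top\in\mathbb R^4:\ f>0,\ b\neq0,\ g>0,\ q>0,\ \alpha fb<\beta gq,\ 2\alpha fb+\beta gq>0\bigr\}.$$ Consider the system $\mathbf u_t+\mathbf F(\mathbf u)_x=0$ with $$\mathbf F(\mathbf u)=\Bigl(\tfrac{\alpha}{2}f^2b,\ \tfrac{\alpha}{2}fb^2,\ \alpha fgb+\tfrac{\beta}{2}g^2q,\ \tfrac{\beta}{2}gq^2+\alpha fbq\Bigr)^\top .$$ (i) On $\mathcal U$, the following functions are independent Riemann invariants for the respective characteristic fields: - for the characteristic speed $\tfrac{\alpha fb}{2}$: $\ fb,\ g,\ q$; - for the characteristic speed $\tfrac{3\alpha fb}{2}$: $\ \dfrac bf,\ \dfrac qg,\ \dfrac{\alpha fb+\beta gq}{\alpha (gq)^{1/4}}$; - for the characteristic speed $\alpha fb+\tfrac{\beta gq}{2}$: $\ f,\ b,\ gq$; - for the characteristic speed $\alpha fb+\tfrac{3\beta gq}{2}$: $\ f,\ b,\ \dfrac gq$. (ii) The functions $$v_1=\frac bf,\qquad v_2=fb,\qquad v_3=\frac qg,\qquad v_4=\frac{\alpha fb+\beta gq}{\alpha(gq)^{1/4}}$$ form a coordinate system of Riemann invariants on $\mathcal U$ (that is, $\mathbf u\mapsto \mathbf V=(v_1,v_2,v_3,v_4)^\top$ is differentiable and invertible onto its image, and each $v_i$ is a Riemann invariant of every characteristic field other than the $i$-th, with the fields numbered in the order listed in (i)). In these variables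 the system is fully diagonal: for smooth solutions with values in $\mathcal U$ it takes the form $$(v_1)_t+\tfrac{\alpha v_2}{2}(v_1)_x=0,\qquad (v_2)_t+\tfrac{3\alpha v_2}{2}(v_2)_x=0,$$ $$(v_3)_t+\Bigl(\alpha v_2+\tfrac{\beta\psi}{2}\Bigr)(v_3)_x=0,\qquad (v_4)_t+\Bigl(\alpha v_2+\tfrac{3\beta\psi}{2}\Bigr)(v_4)_x=0,$$ where $\psi=\psi(v_2,v_4)=gq$, which is a solution $x$ of $\alpha v_2+\beta x-\alpha x^{1/4}v_4=0$.
   Context: For a system $\mathbf u_t+\mathbf F(\mathbf u)_x=0$ with flux Jacobian $\mathbf A(\mathbf u)=\partial\mathbf F/\partial\mathbf u$ diagonalizable with real eigenvalues (characteristic speeds) $\lambda_k(\mathbf u)$ and right eigenvectors $\mathbf r_k(\mathbf u)$, a scalar function $w:\mathcal U\to\mathbb R$ is a Riemann invariant for the $k$-th characteristic field if $\nabla_{\mathbf u}w(\mathbf u)\cdot\mathbf r_k(\mathbf u)=0$ for all $\mathbf u\in\mathcal U$. Riemann invariants are independent if their gradients are linearly independent at every point. The characteristic speeds of the system in the claim are $\tfrac{\alpha fb}{2}$, $\tfrac{3\alpha fb}{2}$, $\alpha fb+\tfrac{\beta gq}{2}$, $\alpha fb+\tfrac{3\beta gq}{2}$. *)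

(* Defs.v *)
From HB Require Import structures.
From mathcomp Require Import all_boot all_order all_algebra.
From mathcomp Require Import all_classical all_reals all_analysis.
Set Implicit Arguments.
Unset Strict Implicit.
Unset Printing Implicit Defensive.
Import Order.TTheory GRing.Theory Num.Theory.
Import numFieldNormedType.Exports.
Local Open Scope classical_set_scope.
Local Open Scope ring_scope.

(* States are row vectors, right eigenvectors are column vectors. *)

(* The library's ['J F u] acts on row vectors from the right, so its (i, j)
   entry is dF_j/du_i; the matrix dF/du is its transpose. *)
Definition flux_jacobian (R : realType) (n : nat)
    (F : 'rV[R]_n -> 'rV[R]_n) (u : 'rV[R]_n) : 'M[R]_n :=
  ('J F u)^T.

Definition grad (R : realType) (n : nat) (w : 'rV[R]_n -> R) (u : 'rV[R]_n)
    : 'rV[R]_n :=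
  \row_j 'D_(delta_mx 0 j) w u.

(* On U, dF/du is diagonalizable, with characteristic speeds [lam u 0 k] and a
   basis of right eigenvectors [r k u]. *)
Definition characteristic_fields (R : realType) (n : nat)
    (F : 'rV[R]_n -> 'rV[R]_n) (U : set 'rV[R]_n)
    (lam : 'rV[R]_n -> 'rV[R]_n) (r : 'I_n -> 'rV[R]_n -> 'cV[R]_n) : Prop :=
  forall u, U u ->
    (forall k, flux_jacobian F u *m r k u = lam u 0 k *: r k u) /\
    (\matrix_(j < n, k < n) r k u j 0) \in unitmx.

Definition riemann_invariant (R : realType) (n : nat) (U : set 'rV[R]_n)
    (rk : 'rV[R]_n -> 'cV[R]_n) (w : 'rV[R]_n -> R) : Prop :=
  forall u, U u -> differentiable w u /\ grad w u *m rk u = 0.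

Definition independent_riemann_invariants (R : realType) (n m : nat)
    (U : set 'rV[R]_n) (rk : 'rV[R]_n -> 'cV[R]_n)
    (w : m.-tuple ('rV[R]_n -> R)) : Prop :=
  (forall i, riemann_invariant U rk (tnth w i)) /\
  (forall u, U u -> row_free (\matrix_(i < m) grad (tnth w i) u)).

Definition riemann_coordinates (R : realType) (n : nat) (U : set 'rV[R]_n)
    (r : 'I_n -> 'rV[R]_n -> 'cV[R]_n) (V : 'rV[R]_n -> 'rV[R]_n) : Prop :=
  [/\ forall u, U u -> differentiable V u,
      set_bij U (V @` U) V
    & forall i k : 'I_n, k != i -> riemann_invariant U (r k) (fun u => V u 0 i)].

(* Points of the plane are pairs (t, x). *)
Definition dir_t (R : realType) : R * R := (1, 0).
Definition dir_x (R : realType) : R * R := (0, 1).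

(* Smoothness is C^1, the regularity of classical solutions. *)
Definition C1_on (R : realType) (n : nat) (O : set (R * R))
    (u : R * R -> 'rV[R]_n) : Prop :=
  forall p, O p ->
    [/\ derivable u p (dir_t R), derivable u p (dir_x R),
        {for p, continuous ('D_(dir_t R) u)}
      & {for p, continuous ('D_(dir_x R) u)}].

(* u_t + F(u)_x = 0 on O.  Existence of the derivatives is required because
   ['D_v f p] is a total operator. *)
Definition solves_conservation_law (R : realType) (n : nat)
    (F : 'rV[R]_n -> 'rV[R]_n) (O : set (R * R)) (u : R * R -> 'rV[R]_n)
    : Prop :=
  forall p, O p ->
    [/\ derivable u p (dir_t R), derivable (F \o u) p (dir_x R)
      & 'D_(dir_t R) u p + 'D_(dir_x R) (F \o u) p = 0].

(* w_t + s w_x = 0 on O. *)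
Definition solves_transport (R : realType) (O : set (R * R))
    (s w : R * R -> R) : Prop :=
  forall p, O p ->
    [/\ derivable w p (dir_t R), derivable w p (dir_x R)
      & 'D_(dir_t R) w p + s p * 'D_(dir_x R) w p = 0].

Definition row4 (R : realType) (a b c d : R) : 'rV[R]_4 :=
  \row_(i < 4) [:: a; b; c; d]`_i.

Definition fc (R : realType) (u : 'rV[R]_4) : R := u 0 0.
Definition bc (R : realType) (u : 'rV[R]_4) : R := u 0 1.
Definition gc (R : realType) (u : 'rV[R]_4) : R := u 0 2.
Definition qc (R : realType) (u : 'rV[R]_4) : R := u 0 3.

Definition stateU (R : realType) (alpha beta : R) : set 'rV[R]_4 :=
  [set u | [/\ 0 < fc u, bc u != 0, 0 < gc u & 0 < qc u] /\
           alpha * fc u * bc u < beta * gc u * qc u /\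
           0 < 2 * alpha * fc u * bc u + beta * gc u * qc u].

Definition flux (R : realType) (alpha beta : R) (u : 'rV[R]_4) : 'rV[R]_4 :=
  let f := fc u in let b := bc u in let g := gc u in let q := qc u in
  row4 (alpha / 2 * f ^+ 2 * b)
       (alpha / 2 * f * b ^+ 2)
       (alpha * f * g * b + beta / 2 * g ^+ 2 * q)
       (beta / 2 * g * q ^+ 2 + alpha * f * b * q).

Definition speeds (R : realType) (alpha beta : R) (u : 'rV[R]_4) : 'rV[R]_4 :=
  let f := fc u in let b := bc u in let g := gc u in let q := qc u in
  row4 (alpha * f * b / 2)
       (3 * alpha * f * b / 2)
       (alpha * f * b + beta * g * q / 2)
       (alpha * f * b + 3 * beta * g * q / 2).

Definition v1 (R : realType) (u : 'rV[R]_4) : R := bc u / fc u.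
Definition v2 (R : realType) (u : 'rV[R]_4) : R := fc u * bc u.
Definition v3 (R : realType) (u : 'rV[R]_4) : R := qc u / gc u.
Definition v4 (R : realType) (alpha beta : R) (u : 'rV[R]_4) : R :=
  (alpha * fc u * bc u + beta * gc u * qc u) /
  (alpha * (gc u * qc u) `^ (1 / 4)).

Definition coordV (R : realType) (alpha beta : R) (u : 'rV[R]_4) : 'rV[R]_4 :=
  row4 (v1 u) (v2 u) (v3 u) (v4 alpha beta u).

(* Main.v *)
Require Import Defs.
From HB Require Import structures.
From mathcomp Require Import all_boot all_order all_algebra.
From mathcomp Require Import all_classical all_reals all_analysis.
From mathcomp Require Import ring lra.
Set Implicit Arguments.
Unset Strict Implicit.
Unset Printing Implicit Defensive.
Import Order.TTheory GRing.Theory Num.Theory.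
Import numFieldNormedType.Exports.
Local Open Scope classical_set_scope.
Local Open Scope ring_scope.

(* On U the four speeds are distinct, so eigenvectors are unique up to scaling
   and every assertion on Riemann invariants reduces to the explicit frame
   (f, -b, 0, 0), (m f, m b, -s g, -s q), (0, 0, g, -q), (0, 0, g, q) with
   m = 3 beta g q - alpha f b > 0 and s = 4 alpha f b.  Independence of gradients
   follows by exhibiting vectors along which the functions have a diagonal
   matrix of directional derivatives with nonzero diagonal.

   If P is the matrix of eigenvectors, A the flux Jacobian, L the diagonal matrix
   of speeds and G the Jacobian of V, then A P = P L and G P is diagonal, hence
   G A = L G; multiplying u_t + A u_x = 0 by the invertible G diagonalizes it.

   With x = gq and p = x^(1/4), v4 is (alpha v2 + beta p^4) / (alpha p), which is
   injective in p where alpha v2 < beta p^4; this yields the injectivity of V and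
   determines psi. *)

(** * Directional derivatives *)

(** Only a directional derivative of [u] is assumed. Restricting to the line through [p] gives a
    curve [c] on [R], where derivability is differentiability, so composition of differentials
    applies to [w \o c]. *)
Lemma chain_rule (R : realType) (E V W : normedModType R) (w : V -> W)
    (u : E -> V) (p v : E) : derivable u p v -> differentiable w (u p) ->
  is_derive p v (w \o u) ('d w (u p) ('D_v u p)).
Proof.
move=> du dw; pose c (h : R) := u (h *: v + p).
have c0 : c 0 = u p by rewrite /c scale0r add0r.
have dc : differentiable c 0.
  exact: (derivable1_diffP c 0).1 ((derivable1P u p v).1 du).
have dcE (Z : normedModType R) (g : E -> Z) :
    'D_v g p = 'D_1 (fun h : R => g (h *: v + p)) 0.
  rewrite /derive; set g1 := (fun h : R => h^-1 *: _).
  set g2 := (fun h : R => h^-1 *: ((_ \o shift 0) _ - _)); suff -> : g1 = g2 by [].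
  by apply/funext => h; rewrite /g1 /g2 /= addr0 scale0r add0r [_%:A]mulr1.
have dwc : differentiable (w \o c) 0 by apply: differentiable_comp => //; rewrite c0.
apply: DeriveDef.
  by apply: (derivable1P _ _ _).2; apply: (derivable1_diffP (w \o c) 0).2.
rewrite (dcE _ (w \o u)) (dcE _ u) (deriveE _ dwc) (deriveE _ dc).
by rewrite -c0 -[RHS]/(('d w (c 0) \o 'd c 0) 1) -diff_comp // c0.
Qed.

Section IsDiff.
Variables (R : realType) (V : normedModType R).

Lemma is_diff_const (x : V) (a : R) : is_diff x (fun=> a) (fun=> 0).
Proof. exact: is_diff_cst. Qed.

Lemma is_diff_mul (x : V) (f g df dg : V -> R) :
  is_diff x f df -> is_diff x g dg ->
  is_diff x (fun y => f y * g y) (fun h => f x * dg h + g x * df h).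
Proof. by move=> ? ?; exact: is_diffM. Qed.

Lemma is_diff_add (x : V) (f g df dg : V -> R) :
  is_diff x f df -> is_diff x g dg ->
  is_diff x (fun y => f y + g y) (fun h => df h + dg h).
Proof. by move=> ? ?; exact: is_diffD. Qed.

Lemma is_diff_comp1 (x : V) (f df : V -> R) (phi : R -> R) (l : R) :
  is_diff x f df -> is_derive (f x) 1 phi l ->
  is_diff x (fun y => phi (f y)) (fun h => l * df h).
Proof.
move=> fx phix.
have dphi : differentiable phi (f x) by apply/derivable1_diffP.
apply: (is_diff_eq (is_diff_comp fx (differentiableP dphi))); apply/funext => h /=.
by rewrite diff1E // derive1E derive_val; exact: mulrC.
Qed.

Lemma is_diff_inv (x : V) (f df : V -> R) : is_diff x f df -> f x != 0 ->
  is_diff x (fun y => (f y)^-1) (fun h => - (f x) ^- 2 * df h).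
Proof.
move=> fx fx0; apply: is_diff_comp1 => //.
have D1 : derivable (id : R -> R) (f x) 1 by exact: derivable_id.
apply: DeriveDef; first exact: (@derivableV _ _ id).
by rewrite (@deriveV _ _ id) // derive_id; exact: mulr1.
Qed.

Lemma is_diff_div (x : V) (f g df dg : V -> R) :
  is_diff x f df -> is_diff x g dg -> g x != 0 ->
  is_diff x (fun y => f y / g y) (fun h => (g x * df h - f x * dg h) / g x ^+ 2).
Proof.
move=> fx gx gx0; apply: (is_diff_eq (is_diff_mul fx (is_diff_inv gx gx0))).
by apply/funext => h /=; field.
Qed.

Lemma is_diff_powR (x : V) (f df : V -> R) (a : R) : is_diff x f df -> 0 < f x ->
  is_diff x (fun y => f y `^ a) (fun h => a * f x `^ (a - 1) * df h).
Proof. by move=> fx f0; exact (is_diff_comp1 fx (is_derive1_powR a f0)). Qed.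

Lemma is_diff_row n (x : V) (F dF : V -> 'rV[R]_n) :
  (forall j, is_diff x (fun y => F y 0 j) (fun h => dF h 0 j)) -> is_diff x F dF.
Proof.
move=> Fx.
pose G := fun y => \sum_(j < n) F y 0 j *: (delta_mx 0 j : 'rV[R]_n).
have FE : F = \sum_(j < n) (fun y => F y 0 j *: (delta_mx 0 j : 'rV[R]_n)).
  by apply/funext => y; rewrite fct_sumE [LHS]row_sum_delta.
have dFx : differentiable F x.
  rewrite FE; apply: differentiable_sum => j; apply: differentiableZl.
  by have dFj := Fx j; exact: ex_diff.
apply: DiffDef => //; apply/funext => h; rewrite -deriveE //.
rewrite derive_mx; last exact: diff_derivable.
apply/rowP => j; have dFj := Fx j.
by rewrite mxE deriveE; [rewrite diff_val | exact: ex_diff].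
Qed.

End IsDiff.

Lemma is_diff_coord (R : realType) m n (M : 'M[R]_(m, n)) i j :
  is_diff M (fun N : 'M[R]_(m, n) => N i j) (fun H => H i j).
Proof.
have dM := differentiable_coord M i j.
apply: DiffDef => //; apply/funext => H; rewrite -deriveE //.
have D : derivable (id : 'M[R]_(m, n) -> _) M H by exact: derivable_id.
by have := derive_mx D; rewrite derive_id => /matrixP /(_ i j); rewrite mxE => <-.
Qed.

Lemma derive_is_diff (R : realType) (V W : normedModType R) (f df : V -> W) x h :
  is_diff x f df -> 'D_h f x = df h.
Proof. by move=> fx; rewrite deriveE; [rewrite diff_val | exact: ex_diff]. Qed.

(** * Riemann invariants of strictly hyperbolic systems *)

Section Gradient.
Variables (R : realType) (n : nat).
Implicit Types (w : 'rV[R]_n -> R) (u h : 'rV[R]_n).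

Lemma derive_grad w u h : differentiable w u ->
  'D_h w u = \sum_j grad w u 0 j * h 0 j.
Proof.
move=> dw; rewrite deriveE // [in LHS](row_sum_delta h) linear_sum.
by apply: eq_bigr => j _; rewrite linearZ /= mxE deriveE // mulrC.
Qed.

Lemma grad_mulmx w u (c : 'cV[R]_n) : differentiable w u ->
  grad w u *m c = const_mx ('D_(c^T) w u).
Proof.
move=> dw; apply/matrixP => i j; rewrite !mxE derive_grad // !ord1.
by apply: eq_bigr => k _; rewrite !mxE.
Qed.

Lemma flux_jacobian_mulmx (F : 'rV[R]_n -> 'rV[R]_n) u (c : 'cV[R]_n) :
  differentiable F u -> flux_jacobian F u *m c = ('D_(c^T) F u)^T.
Proof. by move=> dF; rewrite deriveEjacobian // trmx_mul trmxK. Qed.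

(** [flux_jacobian] makes sense for any map; applied to the coordinate map it is the matrix G of the
    overview, with gradients as rows. *)
Lemma grad_coord (V : 'rV[R]_n -> 'rV[R]_n) u i : differentiable V u ->
  grad (fun x => V x 0 i) u = row i (flux_jacobian V u).
Proof.
move=> dV; apply/rowP => j; rewrite !mxE.
have := deriveEjacobian (delta_mx 0 j) dV.
rewrite derive_mx; last exact: diff_derivable.
by move=> /rowP /(_ i); rewrite -rowE !mxE.
Qed.

End Gradient.

(** * Independence from dual directions *)

Lemma row_free_mul_diag (F : fieldType) m n (A : 'M[F]_(m, n)) B (d : 'rV_m) :
  A *m B = diag_mx d -> (forall i, d 0 i != 0) -> row_free A.
Proof.
move=> AB d0; apply/row_freeP.
exists (B *m diag_mx (\row_i (d 0 i)^-1)); rewrite mulmxA AB mulmx_diag.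
by apply/matrixP => i j; rewrite !mxE divff.
Qed.

(** G A P = G P L = D L = L D = L G P because diagonal matrices commute; then P cancels. *)
Lemma diag_mx_intertwine (F : fieldType) n (A G P : 'M[F]_n) (l d : 'rV_n) :
  P \in unitmx -> A *m P = P *m diag_mx l -> G *m P = diag_mx d ->
  G *m A = diag_mx l *m G.
Proof.
move=> P_unit AP GP; apply: (can_inj (mulmxK P_unit)).
by rewrite -mulmxA AP mulmxA GP -mulmxA GP; exact: diag_mxC.
Qed.

(** The boolean equation on [h] says at once that the matrix of directional derivatives vanishes off
    the diagonal and nowhere on it. *)
Lemma dual_frame_row_free (R : realType) n m (w : m.-tuple ('rV[R]_n -> R))
    (u : 'rV[R]_n) (h : 'I_m -> 'rV[R]_n) :
  (forall i, differentiable (tnth w i) u) ->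
  (forall i k, ('D_(h k) (tnth w i) u == 0) = (i != k)) ->
  row_free (\matrix_(i < m) grad (tnth w i) u).
Proof.
move=> dw dual.
pose d := \row_i 'D_(h i) (tnth w i) u.
apply: (@row_free_mul_diag _ _ _ _ (\matrix_(j, k) h k 0 j) d); last first.
  by move=> i; rewrite mxE dual negbK.
apply/matrixP => i k; rewrite !mxE.
transitivity ('D_(h k) (tnth w i) u).
  by rewrite derive_grad //; apply: eq_bigr => j _; rewrite !mxE.
have [->|ik] := eqVneq i k; first by rewrite mulr1n.
by rewrite mulr0n; apply/eqP; rewrite dual.
Qed.

(** A single product with invertible diagonal value makes both square factors invertible: the frame
    is a basis and V is locally a coordinate change. *)
Lemma dual_frame_unitmx (R : realType) n (V : 'rV[R]_n -> 'rV[R]_n)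
    (u : 'rV[R]_n) (h : 'I_n -> 'rV[R]_n) :
  differentiable V u ->
  (forall i k, ('D_(h k) V u 0 i == 0) = (i != k)) ->
  \matrix_k h k \in unitmx /\ 'J V u \in unitmx.
Proof.
move=> dV dual; pose d := \row_i 'D_(h i) V u 0 i.
have d0 i : d 0 i != 0 by rewrite mxE dual negbK.
have HJ : \matrix_k h k *m 'J V u = diag_mx d.
  apply/row_matrixP => k; rewrite row_mul rowK -deriveEjacobian //.
  apply/rowP => i; rewrite !mxE.
  have [->|ki] := eqVneq k i; first by rewrite mulr1n.
  by rewrite mulr0n; apply/eqP; rewrite dual eq_sym.
split; first by rewrite -row_free_unit; exact: row_free_mul_diag HJ d0.
rewrite -unitmx_tr -row_free_unit.
apply: (@row_free_mul_diag _ _ _ _ (\matrix_k h k)^T d) => //.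
by rewrite -trmx_mul HJ tr_diag_mx.
Qed.

Lemma riemann_invariant_is_diff (R : realType) n (U : set 'rV[R]_n)
    (rk : 'rV[R]_n -> 'cV[R]_n) w (dw : 'rV[R]_n -> 'rV[R]_n -> R) :
  (forall u, U u -> is_diff u w (dw u)) ->
  (forall u, U u -> dw u (rk u)^T = 0) -> riemann_invariant U rk w.
Proof.
move=> wU dw0 u Uu; have wu := wU u Uu; have d_w : differentiable w u := ex_diff.
by split=> //; rewrite grad_mulmx // (derive_is_diff _ wu) dw0.
Qed.

Lemma independent_is_diff (R : realType) n m (U : set 'rV[R]_n)
    (rk : 'rV[R]_n -> 'cV[R]_n) (w : m.-tuple ('rV[R]_n -> R))
    (dw : 'I_m -> 'rV[R]_n -> 'rV[R]_n -> R) (h : 'I_m -> 'rV[R]_n -> 'rV[R]_n) :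
  (forall i u, U u -> is_diff u (tnth w i) (dw i u)) ->
  (forall i u, U u -> dw i u (rk u)^T = 0) ->
  (forall i k u, U u -> (dw i u (h k u) == 0) = (i != k)) ->
  independent_riemann_invariants U rk w.
Proof.
move=> wU dw0 dual; split=> [i | u Uu].
  by apply: riemann_invariant_is_diff (dw0 i); exact: wU.
apply: (dual_frame_row_free (h := h ^~ u)) => [i | i k].
  by have wu := wU i u Uu; exact: ex_diff.
by rewrite (derive_is_diff _ (wU i u Uu)) dual.
Qed.

(** * Change of eigenvector frame and diagonalization *)

Section CharacteristicFields.
Variables (R : realType) (n : nat) (F : 'rV[R]_n -> 'rV[R]_n).
Variables (U : set 'rV[R]_n) (lam : 'rV[R]_n -> 'rV[R]_n).
Implicit Types r : 'I_n -> 'rV[R]_n -> 'cV[R]_n.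

Lemma frame_eigen r u : characteristic_fields F U lam r -> U u ->
  let P := \matrix_(j < n, k < n) r k u j 0 in
  flux_jacobian F u *m P = P *m diag_mx (lam u).
Proof.
move=> rF Uu /=; have [eig _] := rF u Uu; apply/matrixP => i k.
rewrite mul_mx_diag !mxE mulrC.
have /colP /(_ i) := eig k; rewrite !mxE => <-.
by apply: eq_bigr => j _; rewrite !mxE.
Qed.

(** With distinct speeds each eigenspace is a line, so [r' k] is a multiple of [r k] and the
    gradient condition carries over. Results for one frame thus hold for all. *)
Lemma riemann_invariant_strict r r' k w :
  (forall u, U u -> injective (lam u 0)) ->
  characteristic_fields F U lam r -> characteristic_fields F U lam r' ->
  riemann_invariant U (r k) w -> riemann_invariant U (r' k) w.
Proof.
move=> lam_inj rF r'F rw u Uu; have [dw wr0] := rw u Uu; split => //.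
have [_ P_unit] := rF u Uu; have := frame_eigen rF Uu => /=.
set P := \matrix_(_, _) _ in P_unit * => AP.
have [eig' _] := r'F u Uu.
pose c := invmx P *m r' k u.
have r'E : r' k u = P *m c by rewrite /c mulKVmx.
have cE : diag_mx (lam u) *m c = lam u 0 k *: c.
  apply: (can_inj (mulKmx P_unit)).
  by rewrite mulmxA -AP -mulmxA -r'E eig' r'E scalemxAr.
(* Row j of [cE] reads (lam_j - lam_k) c_j = 0. *)
have c0 j : j != k -> c j 0 = 0.
  move=> jk; have /colP /(_ j) := cE; rewrite mul_diag_mx !mxE => /eqP.
  rewrite -subr_eq0 -mulrBl mulf_eq0 subr_eq0 (inj_eq (lam_inj u Uu)).
  by rewrite (negPf jk) => /eqP.
have -> : r' k u = c k 0 *: r k u.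
  rewrite r'E; apply/colP => i; rewrite !mxE (bigD1 k) //= big1 => [|j jk].
    by rewrite !mxE addr0 mulrC.
  by rewrite c0 // mulr0.
by rewrite -scalemxAr wr0 scaler0.
Qed.

Lemma independent_strict r r' k m (w : m.-tuple ('rV[R]_n -> R)) :
  (forall u, U u -> injective (lam u 0)) ->
  characteristic_fields F U lam r -> characteristic_fields F U lam r' ->
  independent_riemann_invariants U (r k) w ->
  independent_riemann_invariants U (r' k) w.
Proof.
move=> lam_inj rF r'F [rw w_free]; split=> // i.
exact: riemann_invariant_strict lam_inj rF r'F (rw i).
Qed.

Lemma riemann_coordinates_intertwine r V u :
  characteristic_fields F U lam r -> riemann_coordinates U r V -> U u ->
  flux_jacobian V u *m flux_jacobian F u = diag_mx (lam u) *m flux_jacobian V u.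
Proof.
move=> rF [dV _ rV] Uu; have [_ P_unit] := rF u Uu.
have := frame_eigen rF Uu => /=.
set P := \matrix_(_, _) _ in P_unit * => AP.
(* The off-diagonal entry (i, k) of G P is the derivative of V_i along [r k], zero by the definition
   of Riemann coordinates. *)
have [d GP] : exists d, flux_jacobian V u *m P = diag_mx d.
  exists (\row_i (flux_jacobian V u *m P) i i); apply/matrixP => i k.
  rewrite [RHS]mxE [in RHS]mxE.
  have [->|ik] := eqVneq i k; first by rewrite mulr1n.
  have [_] := rV i k (contra_neq esym ik) u Uu.
  rewrite grad_coord; last exact: dV.
  move=> /matrixP /(_ 0 0); rewrite mulr0n [RHS]mxE => <-.
  by rewrite !mxE; apply: eq_bigr => j _; rewrite !mxE.
exact: (diag_mx_intertwine P_unit AP GP).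
Qed.

(** The residual of the conservation law, multiplied by the Jacobian of V, is the row of transport
    residuals; invertibility of that Jacobian gives both directions. *)
Theorem riemann_coordinates_diagonalize r V (O : set (R * R))
    (u : R * R -> 'rV[R]_n) :
  (forall x, U x -> differentiable F x) ->
  characteristic_fields F U lam r -> riemann_coordinates U r V ->
  (forall x, U x -> 'J V x \in unitmx) ->
  (forall p, O p -> U (u p)) ->
  (forall p, O p -> derivable u p (dir_t R) /\ derivable u p (dir_x R)) ->
  solves_conservation_law F O u <->
  forall i, solves_transport O (fun p => lam (u p) 0 i) (fun p => V (u p) 0 i).
Proof.
move=> dF rF rV V_unit OU du.
have chainF p (Op : O p) v (D : derivable u p v) :=
  chain_rule D (dF _ (OU p Op)).
have chainV p (Op : O p) v (D : derivable u p v) :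
    is_derive p v (V \o u) ('D_v u p *m 'J V (u p)).
  have [dV _ _] := rV; have dVp := dV _ (OU p Op).
  by rewrite -(deriveEjacobian _ dVp) (deriveE _ dVp); exact: chain_rule.
have chainVi p (Op : O p) v (D : derivable u p v) i :
    is_derive p v (fun q => V (u q) 0 i) (('D_v u p *m 'J V (u p)) 0 i).
  have [dVu VuE] := chainV p Op v D.
  apply: DeriveDef; first exact: ((derivable_mxP _ _ _).1 dVu).
  by rewrite -VuE derive_mx // mxE.
have key p (Op : O p) :
    ('D_(dir_t R) u p + 'D_(dir_x R) (F \o u) p) *m 'J V (u p) =
    \row_i ('D_(dir_t R) (fun q => V (u q) 0 i) p +
      lam (u p) 0 i * 'D_(dir_x R) (fun q => V (u q) 0 i) p).
  have [ut ux] := du p Op.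
  have [_ ->] := chainF p Op _ ux.
  (* Transpose of G A = L G, matching the row-vector convention of ['J]. *)
  have JE : 'J F (u p) *m 'J V (u p) = 'J V (u p) *m diag_mx (lam (u p)).
    apply: trmx_inj; rewrite !trmx_mul tr_diag_mx.
    exact: riemann_coordinates_intertwine rF rV (OU p Op).
  have dFp := dF _ (OU p Op).
  rewrite -(deriveE _ dFp) (deriveEjacobian _ dFp).
  rewrite mulmxDl -(mulmxA _ ('J F (u p)) ('J V (u p))) JE mulmxA mul_mx_diag.
  apply/rowP => i; have [_ Et] := chainVi p Op _ ut i.
  by have [_ Ex] := chainVi p Op _ ux i; rewrite !mxE Et Ex !mxE mulrC.
split=> [sol i p Op | sol p Op]; have [ut ux] := du p Op.
  have [_ _ eq0] := sol p Op.
  have [dVt _] := chainVi p Op _ ut i; have [dVx _] := chainVi p Op _ ux i.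
  split=> //.
  by have := key p Op; rewrite eq0 mul0mx => /rowP /(_ i); rewrite !mxE.
have [dFx _] := chainF p Op _ ux; split=> //.
have J_unit : 'J V (u p) \in unitmx by apply: V_unit; exact: OU.
apply: (can_inj (mulmxK J_unit)); rewrite key // mul0mx.
by apply/rowP => i; rewrite !mxE; have [] := sol i p Op.
Qed.

End CharacteristicFields.

(** * The explicit system *)

(** Turns an index into closed numerals, on which entries of [row4] compute. *)
Lemma ord4_ind (P : 'I_4 -> Prop) : P 0 -> P 1 -> P 2 -> P 3 -> forall i, P i.
Proof.
by move=> P0 P1 P2 P3 [[|[|[|[|//]]]] lti]; [move: P0 | move: P1 | move: P2 | move: P3];
   congr P; apply: val_inj.
Qed.

Lemma ord3_ind (P : 'I_3 -> Prop) : P 0 -> P 1 -> P 2 -> forall i, P i.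
Proof.
by move=> P0 P1 P2 [[|[|[|//]]] lti]; [move: P0 | move: P1 | move: P2];
   congr P; apply: val_inj.
Qed.

Section Row4.
Variable R : realType.

Lemma row4E (a b c d : R) :
  (fc (row4 a b c d) = a) * (bc (row4 a b c d) = b) *
  (gc (row4 a b c d) = c) * (qc (row4 a b c d) = d).
Proof. by rewrite /fc /bc /gc /qc !mxE. Qed.

Lemma is_diff_row4 (V : normedModType R) (x : V) (a b c d da db dc dd : V -> R) :
  is_diff x a da -> is_diff x b db -> is_diff x c dc -> is_diff x d dd ->
  is_diff x (fun y => row4 (a y) (b y) (c y) (d y))
            (fun h => row4 (da h) (db h) (dc h) (dd h)).
Proof.
move=> ax bx cx dx; apply: is_diff_row.
have E (f g df dg : V -> R) : is_diff x f df -> f =1 g -> df =1 dg -> is_diff x g dg.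
  by move=> fx /funext <- /funext <-.
by apply: ord4_ind; [apply: E ax _ _ | apply: E bx _ _ | apply: E cx _ _
  | apply: E dx _ _] => y; rewrite mxE.
Qed.

Lemma is_diff_fc (u : 'rV[R]_4) : is_diff u (@fc R) (@fc R).
Proof. exact: is_diff_coord. Qed.

Lemma is_diff_bc (u : 'rV[R]_4) : is_diff u (@bc R) (@bc R).
Proof. exact: is_diff_coord. Qed.

Lemma is_diff_gc (u : 'rV[R]_4) : is_diff u (@gc R) (@gc R).
Proof. exact: is_diff_coord. Qed.

Lemma is_diff_qc (u : 'rV[R]_4) : is_diff u (@qc R) (@qc R).
Proof. exact: is_diff_coord. Qed.

End Row4.

(** Leaves the derivative as an existential variable and fills it in along the structure of the
    function; [is_diff_eq] then compares it with the intended formula. *)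
Ltac is_diff_struct :=
  repeat first [ exact: is_diff_fc | exact: is_diff_bc | exact: is_diff_gc
    | exact: is_diff_qc | exact: is_diff_const | eapply is_diff_row4
    | eapply is_diff_add | eapply is_diff_mul ].

(** * Differentials of the flux and of V, and the eigenvectors *)

Section System.
Variables (R : realType) (alpha beta : R).
Hypotheses (alpha_gt0 : 0 < alpha) (beta_gt0 : 0 < beta).
Local Notation U := (stateU alpha beta).
Local Notation F := (flux alpha beta).
Local Notation lam := (speeds alpha beta).

Definition dflux (u h : 'rV[R]_4) : 'rV[R]_4 :=
  let f := fc u in let b := bc u in let g := gc u in let q := qc u in
  row4 (alpha * f * b * fc h + alpha / 2 * f ^+ 2 * bc h)
       (alpha / 2 * b ^+ 2 * fc h + alpha * f * b * bc h)
       (alpha * g * b * fc h + alpha * f * g * bc h +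
        (alpha * f * b + beta * g * q) * gc h + beta / 2 * g ^+ 2 * qc h)
       (alpha * b * q * fc h + alpha * f * q * bc h +
        beta / 2 * q ^+ 2 * gc h + (alpha * f * b + beta * g * q) * qc h).

Lemma is_diff_flux u : is_diff u F (dflux u).
Proof.
apply: is_diff_eq; first by rewrite /flux; is_diff_struct.
by apply/funext => h; congr row4 => /=; field.
Qed.

(** Rows, so that they serve as directions of differentiation. In the second vector, [m] is twice
    the fourth speed minus the second, and [s] compensates the contribution 2 alpha f b of (f, b) to
    the (g, q) components. *)
Definition eigvec (k : 'I_4) (u : 'rV[R]_4) : 'rV[R]_4 :=
  let f := fc u in let b := bc u in let g := gc u in let q := qc u in
  let m := 3 * beta * g * q - alpha * f * b in
  let s := 4 * alpha * f * b in
  nth 0 [:: row4 f (- b) 0 0; row4 (m * f) (m * b) (- s * g) (- s * q);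
            row4 0 0 g (- q); row4 0 0 g q] k.

Definition eigframe (k : 'I_4) (u : 'rV[R]_4) : 'cV[R]_4 := (eigvec k u)^T.

Lemma dflux_eigvec k u : dflux u (eigvec k u) = lam u 0 k *: eigvec k u.
Proof.
move: k; apply: ord4_ind; rewrite /dflux /speeds [in RHS]mxE /= /eigvec /= !row4E;
  by apply/rowP; apply: ord4_ind; rewrite !mxE /=; field.
Qed.

Lemma stateU_lt u : U u ->
  [/\ 0 < 3 * beta * gc u * qc u - alpha * fc u * bc u,
      0 < beta * gc u * qc u, 0 < gc u * qc u & alpha * fc u * bc u != 0].
Proof.
case=> -[f0 b0 g0 q0] [lt1 lt2].
have gq0 : 0 < gc u * qc u by rewrite mulr_gt0.
have bgq0 : 0 < beta * gc u * qc u by rewrite -mulrA mulr_gt0.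
split=> //; first lra.
by rewrite !mulf_neq0 // gt_eqF.
Qed.

(** With a = alpha f b and x = beta g q, the differences are a, x, (x + a)/2, (3x + a)/2, (x - a)/2
    and (3x - a)/2. The first is nonzero and the others are positive on U, since 2 (a + x) = (2a +
    x) + x. *)
Lemma speeds_inj u : U u -> injective (lam u 0).
Proof.
move=> Uu; have [m0 x0 _ /eqP s0] := stateU_lt Uu; have [_ [lt1 lt2]] := Uu.
(* As [lra] ignores disequalities, a nonzero a is used by letting [lra] prove a = 0. *)
have s0' : alpha * fc u * bc u = 0 -> False by [].
by apply: ord4_ind; apply: ord4_ind; rewrite !mxE //= => E; exfalso;
   first [ lra | apply: s0'; lra ].
Qed.

(** The last entry writes the derivative of x^(1/4) as x^(1/4) / (4x), so that a single real power
    occurs. *)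
Definition dcoordV (u h : 'rV[R]_4) : 'rV[R]_4 :=
  let f := fc u in let b := bc u in let g := gc u in let q := qc u in
  row4 ((f * bc h - b * fc h) / f ^+ 2)
       (b * fc h + f * bc h)
       ((g * qc h - q * gc h) / g ^+ 2)
       ((alpha * (b * fc h + f * bc h) + beta * (q * gc h + g * qc h)
         - (alpha * f * b + beta * g * q) / (4 * g * q) * (q * gc h + g * qc h))
        / (alpha * (g * q) `^ (1 / 4))).

Lemma is_diff_gq (u : 'rV[R]_4) : is_diff u (fun y => gc y * qc y)
  (fun h => qc u * gc h + gc u * qc h).
Proof.
apply: is_diff_eq; first by is_diff_struct.
by apply/funext => h; ring.
Qed.

Lemma is_diff_v4 u : U u ->
  is_diff u (v4 alpha beta) (fun h => qc (dcoordV u h)).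
Proof.
move=> Uu; have [_ _ x0 _] := stateU_lt Uu; have [[f0 b0 g0 q0] _] := Uu.
have p0 : 0 < (gc u * qc u) `^ (1 / 4) by exact: powR_gt0.
have dS : is_diff u (fun y => alpha * fc y * bc y + beta * gc y * qc y)
    (fun h => alpha * (bc u * fc h + fc u * bc h)
              + beta * (qc u * gc h + gc u * qc h)).
  apply: is_diff_eq; first by is_diff_struct.
  by apply/funext => h /=; ring.
have dp : is_diff u (fun y => alpha * (gc y * qc y) `^ (1 / 4))
    (fun h => alpha * ((gc u * qc u) `^ (1 / 4) / (4 * gc u * qc u)
              * (qc u * gc h + gc u * qc h))).
  apply: (is_diff_eq (is_diff_mul (is_diff_const u alpha)
    (is_diff_powR (1 / 4) (is_diff_gq u) x0))).
  (* Splitting x^(1/4 - 1) as x^(1/4) / x leaves the quarter power as an atom for [field]. *)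
  apply/funext => h /=; rewrite powRB; last by apply/implyP => _; rewrite gt_eqF.
  rewrite powRr1 ?ltW //.
  by field; rewrite !gt_eqF.
have den0 : alpha * (gc u * qc u) `^ (1 / 4) != 0 by rewrite gt_eqF // mulr_gt0.
apply: (is_diff_eq (is_diff_div dS dp den0)).
apply/funext => h /=; rewrite row4E.
by field; rewrite !gt_eqF.
Qed.

Lemma is_diff_coordV u : U u -> is_diff u (coordV alpha beta) (dcoordV u).
Proof.
move=> Uu; have [[f0 b0 g0 q0] _] := Uu.
apply: is_diff_eq.
  apply: is_diff_row4; last exact: is_diff_v4.
  - by apply: is_diff_div; [exact: is_diff_bc | exact: is_diff_fc | rewrite gt_eqF].
  - by rewrite /v2; is_diff_struct.
  - by apply: is_diff_div; [exact: is_diff_qc | exact: is_diff_gc | rewrite gt_eqF].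
by apply/funext => h; rewrite row4E /dcoordV; congr row4; ring.
Qed.

(** G P is diagonal with entries -2b/f, 2mfb, -2q/g and m / (2 alpha (gq)^(1/4)), nonzero because m
    > 0. Invariance, independence and invertibility all draw on this table. *)
Lemma dcoordV_eigvec u i k : U u -> (dcoordV u (eigvec k u) 0 i == 0) = (i != k).
Proof.
move=> Uu; have [m0 x0 gq0 s0] := stateU_lt Uu; have [[f0 b0 g0 q0] _] := Uu.
have p0 : (gc u * qc u) `^ (1 / 4) != 0 by rewrite gt_eqF // powR_gt0.
have nz : [&& fc u != 0, bc u != 0, gc u != 0, qc u != 0, alpha != 0 &
  3 * beta * gc u * qc u - alpha * fc u * bc u != 0].
  by rewrite b0 !gt_eqF.
case/and5P: nz => f1 b1 g1 q1 /andP[a1 m1].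
have zP (x : R) : x = 0 -> (x == 0) = true by move=> ->; exact: eqxx.
have nzP (x y : R) : x = y -> y != 0 -> (x == 0) = false by move=> -> /negbTE.
move: i k; apply: ord4_ind; apply: ord4_ind; rewrite mxE /= /eigvec /= !row4E.
(* The twelve off-diagonal entries vanish identically; the four diagonal ones remain. *)
all: try by apply: zP; field; rewrite ?f1 ?b0 ?g1 ?q1 ?a1 ?p0.
- by apply: (nzP _ (- 2 * bc u / fc u));
    [field | rewrite !mulf_neq0 ?invr_eq0 ?oppr_eq0 ?pnatr_eq0].
- apply: (nzP _ (2 * (3 * beta * gc u * qc u - alpha * fc u * bc u) * fc u * bc u));
    [by ring | by rewrite !mulf_neq0 ?pnatr_eq0].
- by apply: (nzP _ (- 2 * qc u / gc u));
    [field | rewrite !mulf_neq0 ?invr_eq0 ?oppr_eq0 ?pnatr_eq0].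
- apply: (nzP _ ((3 * beta * gc u * qc u - alpha * fc u * bc u)
    / (2 * alpha * (gc u * qc u) `^ (1 / 4)))).
    by field; rewrite g1 q1 a1 p0.
  by rewrite !mulf_neq0 ?invr_eq0 ?mulf_neq0 ?pnatr_eq0.
Qed.

End System.

(** * The explicit frame and the Riemann invariants of each field *)

Section Fields.
Variables (R : realType) (alpha beta : R).
Hypotheses (alpha_gt0 : 0 < alpha) (beta_gt0 : 0 < beta).
Local Notation U := (stateU alpha beta).
Local Notation F := (flux alpha beta).
Local Notation lam := (speeds alpha beta).
Local Notation V := (coordV alpha beta).
Local Notation r0 := (eigframe alpha beta).

Lemma dual_eigvec u : U u -> forall i k,
  ('D_(eigvec alpha beta k u) V u 0 i == 0) = (i != k).
Proof.
move=> Uu i k.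
by rewrite (derive_is_diff _ (is_diff_coordV alpha_gt0 beta_gt0 Uu)) dcoordV_eigvec.
Qed.

Lemma differentiable_coordV u : U u -> differentiable V u.
Proof. by move=> Uu; have dV := is_diff_coordV alpha_gt0 beta_gt0 Uu; exact: ex_diff. Qed.

Lemma differentiable_flux u : differentiable F u.
Proof. by have dF := is_diff_flux alpha beta u; exact: ex_diff. Qed.

(** No determinant is computed: the eigenvectors form a basis because V has a nonsingular diagonal
    matrix of derivatives along them. *)
Lemma eigframe_characteristic : characteristic_fields F U lam r0.
Proof.
move=> u Uu; split=> [k|].
  rewrite flux_jacobian_mulmx; last exact: differentiable_flux.
  rewrite trmxK (derive_is_diff _ (is_diff_flux alpha beta u)) dflux_eigvec.
  by rewrite linearZ.
have [] := dual_frame_unitmx (differentiable_coordV Uu) (dual_eigvec Uu).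
rewrite -unitmx_tr => + _; congr (_ \in unitmx).
by apply/matrixP => i k; rewrite !mxE.
Qed.

Lemma is_diff_coordV_coord u i : U u ->
  is_diff u (fun y => V y 0 i) (fun h => dcoordV alpha beta u h 0 i).
Proof.
move=> Uu; exact: (is_diff_comp (is_diff_coordV alpha_gt0 beta_gt0 Uu)
  (is_diff_coord (V u) 0 i)).
Qed.

Lemma independent_field0 : independent_riemann_invariants U (r0 0)
  [tuple (fun u => fc u * bc u); @gc R; @qc R].
Proof.
pose dw (i : 'I_3) (u h : 'rV[R]_4) : R :=
  nth 0 [:: bc u * fc h + fc u * bc h; gc h; qc h] i.
(* Coordinate directions of f, g and q; the derivative of fb along the first is b, nonzero on U. *)
pose h (k : 'I_3) (u : 'rV[R]_4) : 'rV[R]_4 :=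
  nth 0 [:: row4 1 0 0 0; row4 0 0 1 0; row4 0 0 0 1] k.
apply: (@independent_is_diff _ _ _ _ _ _ dw h).
- apply: ord3_ind => u Uu; rewrite /dw (tnth_nth (fun=> 0)) /=; is_diff_struct.
  apply: is_diff_eq; first by is_diff_struct.
  by apply/funext => y; ring.
- apply: ord3_ind => u Uu; rewrite /dw trmxK /eigvec /= !row4E; ring.
- apply: ord3_ind; apply: ord3_ind => u [[f0 b0 g0 q0] _]; rewrite /dw /h /= !row4E;
    by rewrite ?mulr0 ?addr0 ?mulr1 ?eqxx ?oner_eq0 ?(negbTE b0).
Qed.

Lemma independent_field1 : independent_riemann_invariants U (r0 1)
  [tuple (fun u => bc u / fc u); (fun u => qc u / gc u);
         (fun u => (alpha * fc u * bc u + beta * gc u * qc u) /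
                   (alpha * (gc u * qc u) `^ (1 / 4)))].
Proof.
(* The three functions are v1, v3, v4, and the eigenvectors of the same indices are dual to them. *)
pose s (i : 'I_3) : 'I_4 := nth 0 [:: 0; 2; 3] i.
pose dw i u h := dcoordV alpha beta u h 0 (s i).
pose h k u := eigvec alpha beta (s k) u.
apply: (@independent_is_diff _ _ _ _ _ _ dw h).
- have E u i w : U u -> (fun y => V y 0 (s i)) = w -> is_diff u w (dw i u).
    by move=> Uu <-; exact: is_diff_coordV_coord.
  by apply: ord3_ind => u Uu; rewrite (tnth_nth (fun=> 0)) /=; apply: E => //;
    apply/funext => y; rewrite mxE.
- move=> i u Uu; rewrite /dw trmxK; apply/eqP; rewrite dcoordV_eigvec //.
  by move: i; apply: ord3_ind.
- move=> i k u Uu; rewrite /dw /h dcoordV_eigvec //.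
  by move: i k; apply: ord3_ind; apply: ord3_ind.
Qed.

Lemma independent_field2 : independent_riemann_invariants U (r0 2)
  [tuple @fc R; @bc R; (fun u => gc u * qc u)].
Proof.
pose dw (i : 'I_3) (u h : 'rV[R]_4) : R :=
  nth 0 [:: fc h; bc h; qc u * gc h + gc u * qc h] i.
(* Coordinate directions of f, b and g; the derivative of gq along the last is q > 0. *)
pose h (k : 'I_3) (u : 'rV[R]_4) : 'rV[R]_4 :=
  nth 0 [:: row4 1 0 0 0; row4 0 1 0 0; row4 0 0 1 0] k.
apply: (@independent_is_diff _ _ _ _ _ _ dw h).
- apply: ord3_ind => u Uu; rewrite /dw (tnth_nth (fun=> 0)) /=; is_diff_struct.
  exact: is_diff_gq.
- apply: ord3_ind => u Uu; rewrite /dw trmxK /eigvec /= !row4E; ring.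
- apply: ord3_ind; apply: ord3_ind => u [[f0 b0 g0 q0] _]; rewrite /dw /h /= !row4E;
    by rewrite ?mulr0 ?addr0 ?mulr1 ?eqxx ?oner_eq0 ?(gt_eqF q0).
Qed.

Lemma independent_field3 : independent_riemann_invariants U (r0 3)
  [tuple @fc R; @bc R; (fun u => gc u / qc u)].
Proof.
pose dw (i : 'I_3) (u h : 'rV[R]_4) : R :=
  nth 0 [:: fc h; bc h; (qc u * gc h - gc u * qc h) / qc u ^+ 2] i.
(* Along the direction of g, the derivative of g/q is q / q^2, again nonzero. *)
pose h (k : 'I_3) (u : 'rV[R]_4) : 'rV[R]_4 :=
  nth 0 [:: row4 1 0 0 0; row4 0 1 0 0; row4 0 0 1 0] k.
apply: (@independent_is_diff _ _ _ _ _ _ dw h).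
- apply: ord3_ind => u [[_ _ _ q0] _]; rewrite /dw (tnth_nth (fun=> 0)) /=;
    is_diff_struct.
  by apply: is_diff_div; [exact: is_diff_gc | exact: is_diff_qc | rewrite gt_eqF].
- by apply: ord3_ind => u Uu; rewrite /dw trmxK /eigvec /= !row4E; ring.
- apply: ord3_ind; apply: ord3_ind => u [[f0 b0 g0 q0] _]; rewrite /dw /h /= !row4E;
    rewrite ?mulr0 ?subr0 ?mulr1 ?mul0r ?eqxx ?oner_eq0 //.
  by rewrite mulf_eq0 invr_eq0 sqrf_eq0 (gt_eqF q0).
Qed.

(** * Injectivity of the coordinate map *)

(** Taking p = (gq)^(1/4) as the variable replaces the real power by a rational function of p. *)
Lemma v4E u : U u ->
  exists2 p, 0 < p & gc u * qc u = p ^+ 4 /\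
    v4 alpha beta u = (alpha * v2 u + beta * p ^+ 4) / p / alpha.
Proof.
move=> Uu; have [_ _ x0 _] := stateU_lt alpha_gt0 beta_gt0 Uu.
exists ((gc u * qc u) `^ (1 / 4)); first exact: powR_gt0.
have xE : gc u * qc u = ((gc u * qc u) `^ (1 / 4)) ^+ 4.
  rewrite -powR_mulrn ?powR_ge0 // -powRrM.
  by rewrite (_ : 1 / 4 * 4%:R = 1) ?powRr1 ?ltW //; field.
split=> //; rewrite -xE /v4 /v2; field.
by rewrite !gt_eqF // powR_gt0.
Qed.

(* Since [a < beta y^4, beta z^4], both points lie where [x |-> (a + beta x^4) / x]
   is increasing, its derivative having the sign of [3 beta x^4 - a]. *)
Lemma quartic_quotient_inj (a y z : R) : 0 < y -> 0 < z ->
  a < beta * y ^+ 4 -> a < beta * z ^+ 4 ->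
  (a + beta * y ^+ 4) / y = (a + beta * z ^+ 4) / z -> y = z.
Proof.
wlog yz : y z / y < z.
  move=> H y0 z0 ay az E; have [yz|zy|//] := ltgtP y z; first exact: H.
  by apply/esym/H.
move=> y0 z0 ay _ E; exfalso.
have E1 : (a + beta * y ^+ 4) * z = (a + beta * z ^+ 4) * y.
  by move/eqP: E; rewrite eqr_div ?lt0r_neq0 // => /eqP.
(* The difference of the cross products factors. As z differs from y, the second factor vanishes,
   which contradicts a < beta y^4 because y < z. *)
have E2 : (z - y) * (a - beta * (y * z) * (z ^+ 2 + z * y + y ^+ 2)) = 0.
  by transitivity ((a + beta * y ^+ 4) * z - (a + beta * z ^+ 4) * y);
    [ring | rewrite E1 subrr].
have aE : a = beta * (y * z * (z ^+ 2 + z * y + y ^+ 2)).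
  by move/eqP: E2; rewrite mulf_eq0 subr_eq0 (gt_eqF yz) /= subr_eq0 -mulrA => /eqP.
move: ay; rewrite aE ltr_pM2l // ltNge => /negP; apply.
rewrite [y ^+ 4](_ : _ = y * y * (y ^+ 2)); last by ring.
have yy : y * y <= y * z by rewrite ler_pM2l // ltW.
apply: ler_pM => //; rewrite ?sqr_ge0 ?mulr_ge0 ?(ltW y0) //.
by rewrite lerDr addr_ge0 ?sqr_ge0 // mulr_ge0 // ltW.
Qed.

(** The constraint alpha f b < beta g q of U is exactly the bound selecting the increasing branch of
    the quotient. *)
Lemma gq_unique u u' : U u -> U u' ->
  v2 u = v2 u' -> v4 alpha beta u = v4 alpha beta u' -> gc u * qc u = gc u' * qc u'.
Proof.
move=> Uu Uu' E2 E4.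
have [p p0 [xE v4u]] := v4E Uu; have [p' p0' [xE' v4u']] := v4E Uu'.
have [_ [lt1 _]] := Uu; have [_ [lt1' _]] := Uu'.
rewrite xE xE'; congr (_ ^+ 4).
apply: (@quartic_quotient_inj (alpha * v2 u)) => //.
- by rewrite -xE /v2 !mulrA.
- by rewrite -xE' E2 /v2 !mulrA.
apply: (mulIf (invr_neq0 (lt0r_neq0 alpha_gt0))).
by rewrite -v4u E4 v4u' E2.
Qed.

(** Product over ratio is x^2, and positivity of x selects the root; y may have either sign. *)
Lemma product_ratio_inj (x y x' y' : R) : 0 < x -> 0 < x' -> x * y != 0 ->
  y / x = y' / x' -> x * y = x' * y' -> x = x' /\ y = y'.
Proof.
move=> x0 x0' xy0 Er Ep.
have xE : x = x'.
  have E1 : y * x' = y' * x by move/eqP: Er; rewrite eqr_div ?lt0r_neq0 // => /eqP.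
  have E2 : (x * y) * (x ^+ 2) = (x * y) * (x' ^+ 2).
    transitivity (x ^+ 2 * (x' * y')); first by rewrite Ep mulrC.
    by transitivity (x * x' * (y' * x)); [ring | rewrite -E1; ring].
  by apply/eqP; rewrite -(eqrXn2 (n := 2)) ?(ltW x0) ?(ltW x0') //; apply/eqP/(mulfI xy0).
split=> //; rewrite -xE in Ep.
by move/(mulfI (lt0r_neq0 x0)): Ep.
Qed.

(** v1 and v2 determine (f, b); v2 and v4 determine gq, which with v3 determines (g, q). *)
Lemma coordV_inj : {in U &, injective V}.
Proof.
move=> u u' /set_mem Uu /set_mem Uu' VE.
have VEi i : V u 0 i = V u' 0 i by rewrite VE.
have := VEi 0; have := VEi 1; have := VEi 2; have := VEi 3.
rewrite !mxE /= => E4 E3 E2 E1.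
have [[f0 b0 g0 q0] _] := Uu; have [[f0' b0' g0' q0'] _] := Uu'.
have [fE bE] : fc u = fc u' /\ bc u = bc u'.
  by apply: product_ratio_inj => //; rewrite mulf_neq0 // gt_eqF.
have [gE qE] : gc u = gc u' /\ qc u = qc u'.
  by apply: product_ratio_inj => //; [rewrite mulf_neq0 // gt_eqF | exact: gq_unique].
by apply/rowP; apply: ord4_ind.
Qed.

Lemma riemann_coordinates_eigframe : riemann_coordinates U r0 V.
Proof.
split; [exact: differentiable_coordV | exact/inj_bij/coordV_inj | move=> i k ki].
apply: riemann_invariant_is_diff => u Uu; first exact: is_diff_coordV_coord.
by apply/eqP; rewrite trmxK dcoordV_eigvec // eq_sym.
Qed.

(** * The function psi *)

(** Chosen through states rather than as a root: for v2 > 0 the equation has a second positive root.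
    [gq_unique] makes the choice unambiguous; the default 0 is taken only off the image of (v2,
    v4). *)
Definition psi_gq (a c : R) : R :=
  xget 0 [set x | exists2 u, U u &
    [/\ v2 u = a, v4 alpha beta u = c & x = gc u * qc u]].

Lemma psi_gqE u : U u -> psi_gq (v2 u) (v4 alpha beta u) = gc u * qc u.
Proof.
move=> Uu; rewrite /psi_gq; case: xgetP => [x _ [u' Uu' [E2 E4 ->]] | no].
  exact: gq_unique.
by have [] := no (gc u * qc u); exists u.
Qed.

Lemma psi_gq_root u : U u ->
  let x := psi_gq (v2 u) (v4 alpha beta u) in
  alpha * v2 u + beta * x - alpha * x `^ (1 / 4) * v4 alpha beta u = 0.
Proof.
move=> Uu /=; rewrite psi_gqE //.
have [_ _ x0 _] := stateU_lt alpha_gt0 beta_gt0 Uu.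
by rewrite /v4 /v2; field; rewrite !gt_eqF // powR_gt0.
Qed.

End Fields.

(** * Arbitrary frames and the diagonal system *)

Theorem mainTheorem2 (R : realType) (alpha beta : R)
    (halpha : 0 < alpha) (hbeta : 0 < beta) :
  let U := stateU alpha beta in
  let F := flux alpha beta in
  let lam := speeds alpha beta in
  (exists r, characteristic_fields F U lam r) /\
  (forall r, characteristic_fields F U lam r ->
    [/\ independent_riemann_invariants U (r 0)
          [tuple (fun u => fc u * bc u); @gc R; @qc R],
        independent_riemann_invariants U (r 1)
          [tuple (fun u => bc u / fc u); (fun u => qc u / gc u);
                 (fun u => (alpha * fc u * bc u + beta * gc u * qc u) /
                           (alpha * (gc u * qc u) `^ (1 / 4)))],
        independent_riemann_invariants U (r 2)
          [tuple @fc R; @bc R; (fun u => gc u * qc u)]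
      & independent_riemann_invariants U (r 3)
          [tuple @fc R; @bc R; (fun u => gc u / qc u)]] /\
    riemann_coordinates U r (coordV alpha beta)) /\
  (exists psi : R -> R -> R,
    (forall u, U u ->
       let x := psi (v2 u) (v4 alpha beta u) in
       x = gc u * qc u /\
       alpha * v2 u + beta * x - alpha * x `^ (1 / 4) * v4 alpha beta u = 0) /\
    (forall (O : set (R * R)) (u : R * R -> 'rV[R]_4),
       open O -> C1_on O u -> (forall p, O p -> U (u p)) ->
       let w1 p := v1 (u p) in
       let w2 p := v2 (u p) in
       let w3 p := v3 (u p) in
       let w4 p := v4 alpha beta (u p) in
       let y p := psi (w2 p) (w4 p) in
       solves_conservation_law F O u <->
       [/\ solves_transport O (fun p => alpha * w2 p / 2) w1,
           solves_transport O (fun p => 3 * alpha * w2 p / 2) w2,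
           solves_transport O (fun p => alpha * w2 p + beta * y p / 2) w3
         & solves_transport O (fun p => alpha * w2 p + 3 * beta * y p / 2) w4])).
Proof.
move=> U F lam.
have r0F := eigframe_characteristic halpha hbeta.
have lam_inj u (Uu : U u) := speeds_inj halpha hbeta Uu.
have r0V := riemann_coordinates_eigframe halpha hbeta.
split; first by exists (eigframe alpha beta).
split=> [r rF|].
  (* Both claims are transported from the explicit frame to [r], the speeds being distinct on U. *)
  split; last first.
    have [dV bijV r0V_inv] := r0V; split=> // i k ki.
    exact: riemann_invariant_strict lam_inj r0F rF (r0V_inv i k ki).
  split; apply: (independent_strict lam_inj r0F rF).
  - exact: independent_field0.
  - exact: independent_field1.
  - exact: independent_field2.
  - exact: independent_field3.
exists (psi_gq alpha beta); split=> [u Uu x|O u _ u_C1 OU w1 w2 w3 w4 y].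
  by split; [exact: psi_gqE | exact: psi_gq_root].
have V_unit x : U x -> 'J (coordV alpha beta) x \in unitmx.
  move=> Ux; exact: (dual_frame_unitmx (differentiable_coordV halpha hbeta Ux)
    (dual_eigvec halpha hbeta Ux)).2.
have du p : O p -> derivable u p (dir_t R) /\ derivable u p (dir_x R).
  by move=> Op; have [] := u_C1 p Op.
have dF x : U x -> differentiable F x by move=> _; exact: differentiable_flux.
apply: iff_trans (riemann_coordinates_diagonalize dF r0F r0V V_unit OU du) _.
pose s (i : 'I_4) p := nth 0 [:: alpha * w2 p / 2; 3 * alpha * w2 p / 2;
  alpha * w2 p + beta * y p / 2; alpha * w2 p + 3 * beta * y p / 2] i.
pose w (i : 'I_4) p := nth 0 [:: w1 p; w2 p; w3 p; w4 p] i.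
have wE i : (fun p => coordV alpha beta (u p) 0 i) = w i.
  by apply/funext => p; rewrite mxE.
(* The speeds agree with their expressions in psi only where [u] lies in U, hence the restriction to
   O. *)
have sE i p : O p -> lam (u p) 0 i = s i p.
  move=> Op; have yE : y p = gc (u p) * qc (u p) by exact: psi_gqE (OU p Op).
  rewrite mxE /s /lam yE /w2 /v2; move: i; apply: ord4_ind => /=; ring.
have E i : solves_transport O (fun p => lam (u p) 0 i)
      (fun p => coordV alpha beta (u p) 0 i) <-> solves_transport O (s i) (w i).
  by rewrite wE; split=> sol p Op; have := sol p Op; rewrite sE.
split=> [sol | [sol1 sol2 sol3 sol4]].
  by split; [apply: (E 0).1 | apply: (E 1).1 | apply: (E 2).1 | apply: (E 3).1].
by apply: ord4_ind; apply/E.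
Qed.
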